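(* For every generalized form $\bar\alpha\in\Gamma\Lambda^p(M,\mathcal F(J^k_0(M)))$ and every vector field $X\in\Gamma TM$, $$(\iota_X\circ d_4+d_4\circ\iota_X)(\bar\alpha)={}^k\zeta^{-1}\,\hat h_k\Big(\mathcal L_{{}^hX}\,{}^k\zeta(\bar\alpha)\Big),$$ where $\mathcal L_{{}^hX}$ is the ordinary Lie derivative of forms on $J^k_0(M)$ along the horizontal lift ${}^hX$.
   Context: $M$ is a smooth $n$-dimensional Hausdorff second countable manifold with a pseudo-Riemannian metric $\eta$ of signature $(-1,1,\dots,1)$ and Levi-Civita connection $D$. ${}^k\pi:J^k_0(M)\to M$ ($k\ge1$) is the bundle of $k$-jets at $0$ of smooth curves in $M$. $\mathcal F(\cdot)$ denotes smooth real functions. A connection on $J^k_0(M)$ is a splitting $TJ^k_0(M)={}^k\hat{\mathcal H}\oplus{}^k\mathcal V$ with ${}^k\mathcal V=\ker({}^k\pi_* )$. An induced connection is one with ${}^kpr_*({}^k\hat{\mathcal H})\subset\mathcal H_D$, where ${}^kpr:J^k_0(M)\to TM$ is the natural projection and $\mathcal H_D\subset TTM$ is the horizontal distribution of $D$. An induced connection is fixed; ${}^hX$ is the horizontal lift to $J^k_0(M)$ of a vector field $X$ on $M$. $\Gamma\Lambda^p(M,\mathcal F(J^k_0(M)))$, the generalized $p$-forms, is the space of alternating $\mathcal F(M)$-multilinear maps from $p$ vector fields on $M$ to $\mathcal F(J^k_0(M))$ (locally $\alpha_I({}^kx)\,dx^I$). $\Gamma\Lambda^p_h(J^k_0(M))$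 is the space of $p$-forms on $J^k_0(M)$ vanishing whenever one argument is vertical. The isomorphism ${}^k\zeta:\Gamma\Lambda^p(M,\mathcal F(J^k_0(M)))\to\Gamma\Lambda^p_h(J^k_0(M))$ is characterized by $({}^k\zeta\bar\alpha)({}^hX_1,\dots,{}^hX_p)=\bar\alpha(X_1,\dots,X_p)$. $\hat h_k$ sends a form on $J^k_0(M)$ to its horizontal component with respect to ${}^k\hat{\mathcal H}$ (agreeing with the form on horizontal vectors, zero if an argument is vertical). With $d_J$ the exterior derivative on $J^k_0(M)$, define $d_4\bar\alpha:={}^k\zeta^{-1}\hat h_k(d_J\,{}^k\zeta\bar\alpha)$ and $\iota_X\bar\alpha:={}^k\zeta^{-1}\,\iota_{{}^hX}\,{}^k\zeta\bar\alpha$. *)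

(* Defs.v *)
From HB Require Import structures.
From mathcomp Require Import all_boot all_order all_algebra.
From mathcomp Require Import all_classical all_reals all_analysis.
Set Implicit Arguments.
Unset Strict Implicit.
Unset Printing Implicit Defensive.
Import Order.TTheory GRing.Theory Num.Theory.
Import numFieldNormedType.Exports.
Local Open Scope classical_set_scope.
Local Open Scope ring_scope.

(* For an open subset U of a finite-dimensional V: all iterated directional
   derivatives of f up to order m exist and are continuous on U. *)
Fixpoint Cn_on (R : realType) (V W : normedModType R) (m : nat) (U : set V)
    (f : V -> W) : Prop :=
  match m with
  | 0%N => forall x, U x -> {for x, continuous f}
  | q.+1 => [/\ forall x, U x -> {for x, continuous f},
                forall x v, U x -> derivable f x v &
                forall v, Cn_on q U ('D_v f)]
  end.

Definition smooth_on (R : realType) (V W : normedModType R) (U : set V)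
    (f : V -> W) : Prop :=
  forall m, Cn_on m U f.

Section CnTheory.
Variable R : realType.
Implicit Types V W : normedModType R.

Lemma Cn_continuous V W m (U : set V) (f : V -> W) :
  Cn_on m U f -> forall x, U x -> {for x, continuous f}.
Proof. by case: m => [|m] // -[]. Qed.

Lemma CnS V W m (U : set V) (f : V -> W) : Cn_on m.+1 U f -> Cn_on m U f.
Proof.
elim: m f => [|m IH] f; first by case.
by move=> [cf df Df]; split=> // v; apply: IH; exact: Df.
Qed.

Lemma Cn_ext V W m (U : set V) (f g : V -> W) : open U ->
  (forall x, U x -> f x = g x) -> Cn_on m U f -> Cn_on m U g.
Proof.
move=> oU.
have nfg (a b : V -> W) x : (forall x, U x -> a x = b x) -> U x ->
    \forall y \near x, a y = b y.
  by move=> ab Ux; near=> y; apply: ab; near: y; exact: open_nbhs_nbhs.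
have cont (a b : V -> W) : (forall x, U x -> a x = b x) ->
    (forall x, U x -> {for x, continuous a}) ->
    forall x, U x -> {for x, continuous b}.
  move=> ab ca x Ux; have := ca x Ux.
  rewrite /prop_for /continuous_at -(ab x Ux); apply: cvg_trans.
  apply: near_eq_cvg.
  by near do apply: ab; exact: open_nbhs_nbhs.
elim: m f g => [|m IH] f g fg; first exact: cont.
move=> [cf df Df]; split; first exact: cont cf.
  move=> x v Ux; exact: near_eq_derivable (nfg _ _ _ fg Ux) (df x v Ux).
move=> v; apply: IH (Df v) => x Ux; apply: near_eq_derive; exact: nfg.
Unshelve. all: by end_near. Qed.

Lemma Cn_cst V W m (U : set V) (a : W) : Cn_on m U (cst a).
Proof.
elim: m a => [|m IH] a /=; first by move=> x _; exact: cvg_cst.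
split=> [x _|x v _|v]; [exact: cvg_cst|exact: derivable_cst|].
rewrite (_ : 'D_v _ = cst 0)//; apply/funext => x; exact: derive_cst.
Qed.

Lemma CnD V W m (U : set V) (f g : V -> W) : open U ->
  Cn_on m U f -> Cn_on m U g -> Cn_on m U (f + g).
Proof.
move=> oU; elim: m f g => [|m IH] f g /=.
  by move=> cf cg x Ux; apply: cvgD; [exact: cf|exact: cg].
move=> [cf df Df] [cg dg Dg]; split=> [x Ux|x v Ux|v].
- by apply: cvgD; [exact: cf|exact: cg].
- by apply: derivableD; [exact: df|exact: dg].
- apply: (@Cn_ext _ _ _ _ ('D_v f + 'D_v g)) => //.
  + by move=> x Ux; rewrite deriveD//; [exact: df|exact: dg].
  + exact: IH.
Qed.

Lemma CnM V m (U : set V) (f g : V -> R) : open U ->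
  Cn_on m U f -> Cn_on m U g -> Cn_on m U (f * g).
Proof.
move=> oU; elim: m f g => [|m IH] f g.
  by move=> cf cg x Ux; apply: cvgM; [exact: cf|exact: cg].
move=> Cf Cg; case: (Cf) => cf df Df; case: (Cg) => cg dg Dg.
split=> [x Ux|x v Ux|v].
- by apply: cvgM; [exact: cf|exact: cg].
- by apply: derivableM; [exact: df|exact: dg].
- apply: (@Cn_ext _ _ _ _ (f * 'D_v g + g * 'D_v f)) => //.
  + by move=> x Ux; rewrite [RHS]deriveM; [|exact: df|exact: dg].
  + by apply: CnD => //; (apply: IH; [exact: CnS|]); [exact: Dg|exact: Df].
Qed.

Lemma Cn_lin V1 V2 W m (L : {linear V1 -> V2}) (U : set V1) (U' : set V2)
    (f : V2 -> W) : continuous L -> (forall x, U x -> U' (L x)) ->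
  Cn_on m U' f -> Cn_on m U (f \o L).
Proof.
move=> cL UU'.
have shiftE (g : V2 -> W) x v :
    (fun h : R => h^-1 *: (((g \o L) \o shift x) (h *: v) - (g \o L) x)) =
    (fun h : R => h^-1 *: ((g \o shift (L x)) (h *: L v) - g (L x))).
  by apply/funext => h; rewrite /= linearP.
elim: m f => [|m IH] f.
  by move=> cf x Ux; apply: continuous_comp; [exact: cL|exact/cf/UU'].
move=> [cf df Df]; split=> [x Ux|x v Ux|v].
- by apply: continuous_comp; [exact: cL|exact/cf/UU'].
- by rewrite /derivable shiftE; exact/df/UU'.
- rewrite (_ : 'D_v _ = 'D_(L v) f \o L); first by apply: IH; exact: Df.
  by apply/funext => x; rewrite /derive shiftE.
Qed.

Lemma continuous_mxsub (m n m' n' : nat) (g : 'I_m' -> 'I_m)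
  (h : 'I_n' -> 'I_n) : continuous (@mxsub R _ _ _ _ g h).
Proof.
move=> A P /nbhs_ballP[e e0 AP]; apply/nbhs_ballP; exists e => //= B [_ AB].
by apply: AP; split=> // i j; rewrite !mxE.
Qed.

End CnTheory.

(* Only what is needed to speak of smooth functions: a set of points together
   with charts onto open subsets of the model space E. *)
Record chartedSpace (R : realType) (E : normedModType R) := ChartedSpace {
  cs_pt :> Type;
  cs_chart : Type;
  cs_dom : cs_chart -> set cs_pt;
  cs_map : cs_chart -> cs_pt -> E;
  cs_img : cs_chart -> set E;
  cs_img_open : forall c, open (cs_img c) }.

Section SmoothFunctions.
Variables (R : realType) (E : normedModType R) (X : chartedSpace E).

Definition smooth_fun (f : X -> R) : Prop :=
  forall c : cs_chart X, exists2 F : E -> R,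
    smooth_on (cs_img c) F & forall x, cs_dom c x -> f x = F (cs_map c x).

Definition smooth_pred : {pred X -> R} := mem [set f | smooth_fun f].

Lemma smooth_predP f : reflect (smooth_fun f) (f \in smooth_pred).
Proof. exact: (iffP (asboolP _)). Qed.

Lemma smooth_fun_cst (a : R) : smooth_fun (cst a).
Proof. by move=> c; exists (cst a) => // m; exact: Cn_cst. Qed.

Lemma smooth_funD (f g : X -> R) :
  smooth_fun f -> smooth_fun g -> smooth_fun (f + g).
Proof.
move=> sf sg c; have [F sF fF] := sf c; have [G sG gG] := sg c.
exists (F + G) => [m|x xc]; first by apply: CnD => //; exact: cs_img_open.
by rewrite -[LHS]/(f x + g x) fF// gG.
Qed.

Lemma smooth_funM (f g : X -> R) :
  smooth_fun f -> smooth_fun g -> smooth_fun (f * g).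
Proof.
move=> sf sg c; have [F sF fF] := sf c; have [G sG gG] := sg c.
exists (F * G) => [m|x xc]; first by apply: CnM => //; exact: cs_img_open.
by rewrite -[LHS]/(f x * g x) fF// gG.
Qed.

Lemma smooth_funZ (a : R) (f : X -> R) : smooth_fun f -> smooth_fun (a *: f).
Proof. by move=> sf; apply: smooth_funM => //; exact: smooth_fun_cst. Qed.

Lemma smooth_pred_subring : subring_closed smooth_pred.
Proof.
split=> [|f g /smooth_predP sf /smooth_predP sg|f g /smooth_predP sf
  /smooth_predP sg]; apply/smooth_predP.
- exact: smooth_fun_cst.
- rewrite -scaleN1r; apply: smooth_funD => //; exact: smooth_funZ.
- exact: smooth_funM.
Qed.

Lemma smooth_pred_scaler : scaler_closed smooth_pred.
Proof. by move=> a f /smooth_predP sf; apply/smooth_predP/smooth_funZ. Qed.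

HB.instance Definition _ :=
  GRing.isSubringClosed.Build _ smooth_pred smooth_pred_subring.
HB.instance Definition _ :=
  GRing.isScaleClosed.Build _ _ smooth_pred smooth_pred_scaler.

End SmoothFunctions.
Arguments smooth_pred {R E} X.

(* The ring F(X) of smooth real functions on X. *)
Record smoothFun (R : realType) (E : normedModType R) (X : chartedSpace E) :=
  SmoothFun { sf_val :> X -> R; sf_valP : sf_val \in smooth_pred X }.

Section SmoothFunInstances.
Variables (R : realType) (E : normedModType R) (X : chartedSpace E).

HB.instance Definition _ := [isSub of smoothFun X for @sf_val R E X].
HB.instance Definition _ := [Choice of smoothFun X by <:].
HB.instance Definition _ := GRing.SubChoice_isSubComPzRing.Build _ _
  (smoothFun X) (GRing.subringClosedP _).
HB.instance Definition _ := [SubZmodule_isSubLmodule of smoothFun X by <:].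

End SmoothFunInstances.

Section VectorFields.
Variables (R : realType) (E : normedModType R) (X : chartedSpace E).
Local Notation F := (smoothFun X).

Definition tangent_space (x : X) : set (F -> R) :=
  [set v | (forall (a : R) (f g : F), v (a *: f + g) = a * v f + v g) /\
           (forall f g : F, v (f * g) = f x * v g + g x * v f)].

(* Smooth sections of the tangent bundle, as derivations of F(X); the value of
   Y at x is the point derivation f |-> (Y f)(x). *)
Record vfield := VField {
  vf_fun :> F -> F;
  vf_linear : forall (a : R) (f g : F), vf_fun (a *: f + g) = a *: vf_fun f + vf_fun g;
  vf_leibniz : forall f g : F, vf_fun (f * g) = f * vf_fun g + g * vf_fun f }.

Definition vf_at (Y : vfield) (x : X) : F -> R := fun f => Y f x.

Lemma vfieldP (Y Z : vfield) : (forall f, Y f = Z f) -> Y = Z.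
Proof.
case: Y Z => [Y Yl Yd] [Z Zl Zd] /= YZ.
have {}YZ : Y = Z by apply/funext.
by subst Z; congr VField; exact: Prop_irrelevance.
Qed.

HB.instance Definition _ := gen_eqMixin vfield.
HB.instance Definition _ := gen_choiceMixin vfield.

Lemma vfD (Y : vfield) (f g : F) : Y (f + g) = Y f + Y g.
Proof. by rewrite -[f in LHS]scale1r vf_linear scale1r. Qed.

Definition vf_zero : vfield.
Proof.
exists (fun=> 0) => [a f g|f g]; first by rewrite scaler0 addr0.
by rewrite !mulr0 addr0.
Defined.

Definition vf_opp (Y : vfield) : vfield.
Proof.
exists (fun f => - Y f) => [a f g|f g].
  by rewrite vf_linear opprD scalerN.
by rewrite vf_leibniz opprD !mulrN.
Defined.

Definition vf_add (Y Z : vfield) : vfield.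
Proof.
exists (fun f => Y f + Z f) => [a f g|f g].
  by rewrite !vf_linear scalerDr addrACA.
by rewrite !vf_leibniz !mulrDr addrACA.
Defined.

Definition vf_scale (h : F) (Y : vfield) : vfield.
Proof.
exists (fun f => h * Y f) => [a f g|f g].
  rewrite vf_linear mulrDr; congr (_ + _).
  by apply: val_inj; apply/funext => x; rewrite /= mulrCA.
by rewrite vf_leibniz mulrDr mulrCA (mulrCA h).
Defined.

Lemma vf_addA : associative vf_add.
Proof. by move=> Y Z W; apply: vfieldP => f /=; rewrite addrA. Qed.
Lemma vf_addC : commutative vf_add.
Proof. by move=> Y Z; apply: vfieldP => f /=; rewrite addrC. Qed.
Lemma vf_add0 : left_id vf_zero vf_add.
Proof. by move=> Y; apply: vfieldP => f /=; rewrite add0r. Qed.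
Lemma vf_addN : left_inverse vf_zero vf_opp vf_add.
Proof. by move=> Y; apply: vfieldP => f /=; rewrite addNr. Qed.

HB.instance Definition _ :=
  GRing.isZmodule.Build vfield vf_addA vf_addC vf_add0 vf_addN.

Lemma vf_scaleA a b Y : vf_scale a (vf_scale b Y) = vf_scale (a * b) Y.
Proof. by apply: vfieldP => f /=; rewrite mulrA. Qed.
Lemma vf_scale1 : left_id 1 vf_scale.
Proof. by move=> Y; apply: vfieldP => f /=; rewrite mul1r. Qed.
Lemma vf_scaleDr : right_distributive vf_scale +%R.
Proof. by move=> a Y Z; apply: vfieldP => f /=; rewrite mulrDr. Qed.
Lemma vf_scaleDl Y : {morph vf_scale^~ Y : a b / a + b}.
Proof. by move=> a b; apply: vfieldP => f /=; rewrite mulrDl. Qed.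

HB.instance Definition _ := GRing.Zmodule_isLmodule.Build F vfield
  vf_scaleA vf_scale1 vf_scaleDr vf_scaleDl.

Definition bracket (Y Z : vfield) : vfield.
Proof.
exists (fun f => Y (Z f) - Z (Y f)) => [a f g|f g].
  by rewrite !vf_linear scalerBr opprD addrACA.
rewrite !vf_leibniz !vfD !vf_leibniz !mulrBr.
rewrite (mulrC (Y g) (Z f)) (mulrC (Y f) (Z g)) addrACA.
rewrite [X in _ - X]addrACA [Z f * _ + _]addrC opprD [LHS]addrACA subrr addr0.
by rewrite opprD [LHS]addrACA.
Defined.

End VectorFields.

(* A p-tuple of arguments is a function on 'I_p; a map on p-tuples is not
   required to be multilinear or alternating until is_form says so. *)
Section Forms.
Variables (A B : comPzRingType) (rho : A -> B) (V : lmodType A).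

Definition is_form (p : nat) (w : ('I_p -> V) -> B) : Prop :=
  (forall (Y : 'I_p -> V) i (a : A) U W,
     w [eta Y with i |-> a *: U + W] =
     rho a * w [eta Y with i |-> U] + w [eta Y with i |-> W]) /\
  (forall (Y : 'I_p -> V) i j, i != j -> Y i = Y j -> w Y = 0).

Definition cons_arg (p : nat) (U : V) (Y : 'I_p -> V) : 'I_p.+1 -> V :=
  fun i => if unlift ord0 i is Some j then Y j else U.

Definition contraction (U : V) (p : nat) (w : ('I_p.+1 -> V) -> B) :
    ('I_p -> V) -> B :=
  fun Y => w (cons_arg U Y).

End Forms.

Section ExteriorCalculus.
Variables (R : realType) (E : normedModType R) (X : chartedSpace E).
Local Notation F := (smoothFun X).
Local Notation vfield := (vfield X).

(* The invariant (Koszul) formula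
     dw(Y_0,...,Y_p) = sum_i (-1)^i Y_i(w(..^Y_i..))
       + sum_(i<j) (-1)^(i+j) w([Y_i,Y_j], ..^Y_i..^Y_j..);
   below, k |-> lift j (lift i' k) enumerates the indices other than i < j. *)
Definition ext_d (p : nat) : (('I_p -> vfield) -> F) -> ('I_p.+1 -> vfield) -> F :=
  match p with
  | 0%N => fun w Y => Y ord0 (w (Y \o lift ord0))
  | q.+1 => fun w Y =>
      \sum_(i < q.+2) (-1) ^+ i * Y i (w (Y \o lift i)) +
      \sum_(i < q.+2) \sum_(j < q.+2 | (i < j)%N)
        (-1) ^+ (i + j) *
        w (cons_arg (bracket (Y i) (Y j))
             (fun k : 'I_q => Y (lift j (lift (inord i : 'I_q.+1) k))))
  end.

Definition lie_derivative (U : vfield) (p : nat) (w : ('I_p -> vfield) -> F) :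
    ('I_p -> vfield) -> F :=
  fun Y => U (w Y) - \sum_(i < p) w [eta Y with i |-> bracket U (Y i)].

End ExteriorCalculus.

Record manifold (R : realType) (n : nat) := Manifold {
  mf_pt :> topologicalType;
  mf_hausdorff : hausdorff_space mf_pt;
  mf_second_countable : @second_countable mf_pt;
  mf_chart : Type;
  mf_dom : mf_chart -> set mf_pt;
  mf_map : mf_chart -> mf_pt -> 'rV[R]_n;
  mf_dom_open : forall c, open (mf_dom c);
  mf_cover : forall x, exists c, mf_dom c x;
  (* each chart is a homeomorphism of its domain onto an open subset of R^n *)
  mf_inj : forall c, {in mf_dom c &, injective (mf_map c)};
  mf_cont : forall c x, mf_dom c x -> {for x, continuous (mf_map c)};
  mf_openmap : forall c (W : set mf_pt), open W -> W `<=` mf_dom c ->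
    open (mf_map c @` W);
  mf_transition : forall c c', exists2 f : 'rV[R]_n -> 'rV[R]_n,
    smooth_on (mf_map c @` (mf_dom c `&` mf_dom c')) f &
    forall x, mf_dom c x -> mf_dom c' x -> mf_map c' x = f (mf_map c x) }.

Section JetBundles.
Variables (R : realType) (n : nat) (M : manifold R n).

Lemma mf_img_open (c : mf_chart M) : open (mf_map c @` mf_dom c).
Proof. by apply: mf_openmap => //; exact: mf_dom_open. Qed.

Definition base : chartedSpace 'rV[R]_n :=
  @ChartedSpace R _ M (mf_chart M) (@mf_dom _ _ M) (@mf_map _ _ M) _ mf_img_open.

(* germs at 0 of smooth curves: only the values near 0 are constrained *)
Definition smooth_curve (g : R -> M) : Prop :=
  exists2 e : R, 0 < e & forall t, `|t| < e -> {for t, continuous g} /\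
    forall c : mf_chart M, mf_dom c (g t) ->
      exists2 d : R, 0 < d & smooth_on (ball t d) (mf_map c \o g).

Definition jet_equiv (k : nat) (g h : R -> M) : Prop :=
  g 0 = h 0 /\ forall c : mf_chart M, mf_dom c (g 0) ->
    forall i, (i <= k)%N ->
      derive1n i (mf_map c \o g) 0 = derive1n i (mf_map c \o h) 0.

Record jet (k : nat) := Jet {
  jet_class : set (R -> M);
  jet_classP : exists2 g, smooth_curve g &
    jet_class = [set h | smooth_curve h /\ jet_equiv k g h] }.

Lemma jet_nonempty k (j : jet k) : exists g, jet_class j g.
Proof. by case: (jet_classP j) => g sg ->; exists g. Qed.

Definition jet_rep k (j : jet k) : R -> M := sval (cid (jet_nonempty j)).

Lemma jet_repP k (j : jet k) : jet_class j (jet_rep j).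
Proof. exact: svalP (cid (jet_nonempty j)). Qed.

Lemma jet_rep_smooth k (j : jet k) : smooth_curve (jet_rep j).
Proof.
by have := jet_repP j; case: (jet_classP j) => g _ ->; case.
Qed.

Definition jet_of k g (sg : smooth_curve g) : jet k :=
  @Jet k [set h | smooth_curve h /\ jet_equiv k g h]
    (ex_intro2 _ _ g sg erefl).

Lemma jet_rep_of k g (sg : smooth_curve g) :
  jet_equiv k g (jet_rep (@jet_of k g sg)).
Proof. by have [] := jet_repP (jet_of k sg). Qed.

Definition jet_pi k (j : jet k) : M := jet_rep j 0.

(* row i of the coordinates of a jet is the i-th derivative at 0 *)
Definition jet_coord k (c : mf_chart M) (j : jet k) : 'M[R]_(k.+1, n) :=
  \matrix_(i < k.+1, l < n) derive1n i (mf_map c \o jet_rep j) 0 ord0 l.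

Definition jet_img k (c : mf_chart M) : set 'M[R]_(k.+1, n) :=
  [set a | (mf_map c @` mf_dom c) (row ord0 a)].

Lemma jet_img_open k c : open (@jet_img k c).
Proof.
have -> : @jet_img k c = row ord0 @^-1` (mf_map c @` mf_dom c) by [].
apply: open_comp; last exact: mf_img_open.
by move=> a _; exact: continuous_mxsub.
Qed.

Definition jets k : chartedSpace 'M[R]_(k.+1, n) :=
  @ChartedSpace R _ (jet k) (mf_chart M) (fun c => @jet_pi k @^-1` mf_dom c)
    (@jet_coord k) _ (@jet_img_open k).

Lemma jet_pi_smooth k (f : smoothFun base) :
  smooth_fun (X := jets k) (f \o @jet_pi k).
Proof.
move=> c; have /smooth_predP/(_ c)[F sF fF] := sf_valP f.
exists (F \o row ord0) => [m|j jc].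
  by apply: (Cn_lin (@continuous_mxsub _ _ _ _ _ _ _)) (sF m) => a.
rewrite /= fF //; congr (F _); apply/rowP => l.
by rewrite !mxE.
Qed.

Definition jet_pull k (f : smoothFun base) : smoothFun (jets k) :=
  SmoothFun (introT (smooth_predP _) (@jet_pi_smooth k f)).

(* The tangent bundle TM is taken to be J^1_0(M); the tangent vector u acts on
   functions by the derivative along a curve representing it. *)
Definition velocity (u : jet 1) (f : smoothFun base) : R :=
  derive1 (f \o jet_rep u) 0.

Definition jet_pr k (j : jet k.+1) : jet 1 := jet_of 1 (jet_rep_smooth j).

Lemma jet_pr_pi k (j : jet k.+1) : jet_pi (jet_pr j) = jet_pi j.
Proof. by have [/esym e _] := jet_rep_of 1 (jet_rep_smooth j). Qed.

Lemma jet_pr_smooth k (f : smoothFun (jets 1)) :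
  smooth_fun (X := jets k.+1) (f \o @jet_pr k).
Proof.
move=> c; have /smooth_predP/(_ c)[F sF fF] := sf_valP f.
pose trunc := @widen_ord 2 k.+2 isT.
exists (F \o rowsub trunc) => [m|j jc].
  apply: (Cn_lin (@continuous_mxsub _ _ _ _ _ _ _)) (sF m) => a.
  rewrite /= /jet_img/= (_ : row _ (rowsub _ _) = row ord0 a) //.
  by apply/rowP => l; rewrite !mxE; congr (a _ _); exact: val_inj.
rewrite /= fF /=; last by rewrite jet_pr_pi.
congr (F _); apply/matrixP => i l; rewrite !mxE.
have [_ /(_ c jc)] := jet_rep_of 1 (jet_rep_smooth j).
by move=> /(_ i (ltn_ord i)) /= ->.
Qed.

Definition jet_pr_pull k (f : smoothFun (jets 1)) : smoothFun (jets k.+1) :=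
  SmoothFun (introT (smooth_predP _) (@jet_pr_smooth k f)).

End JetBundles.

Section LeviCivita.
Variables (R : realType) (n : nat) (M : manifold R n.+1).
Local Notation FM := (smoothFun (base M)).
Local Notation VM := (vfield (base M)).

(* Signature (-1,1,...,1); the orthonormal basis also gives nondegeneracy. *)
Definition lorentz_metric (eta : VM -> VM -> FM) : Prop :=
  [/\ forall (a : FM) (X Y Z : VM), eta (a *: X + Y) Z = a * eta X Z + eta Y Z,
      forall X Y : VM, eta X Y = eta Y X &
      forall x : M, exists2 e : 'I_n.+1 -> VM,
        forall i j, eta (e i) (e j) x =
          if i == j then (if i == ord0 then -1 else 1) else 0 &
        forall v, tangent_space (X := base M) x v ->
          exists c : 'I_n.+1 -> R, forall f, v f = \sum_i c i * e i f x].

(* D X Y is the covariant derivative of Y along X *)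
Definition levi_civita (eta : VM -> VM -> FM) (D : VM -> VM -> VM) : Prop :=
  [/\ forall (a : FM) (X Y Z : VM), D (a *: X + Y) Z = a *: D X Z + D Y Z,
      forall X Y Z : VM, D X (Y + Z) = D X Y + D X Z,
      forall (a : FM) (X Y : VM), D X (a *: Y) = X a *: Y + a *: D X Y,
      forall X Y : VM, D X Y - D Y X = bracket X Y &
      forall X Y Z : VM, X (eta Y Z) = eta (D X Y) Z + eta Y (D X Z)].

(* X(m) = u as tangent vectors at m = jet_pi u *)
Definition passes_through (X : VM) (u : jet M 1) : Prop :=
  forall f : FM, velocity u f = X f (jet_pi u).

(* The horizontal distribution of D on TM: at u in T_m M it consists of the
   vectors X_*(V(m)) where X(m) = u and (D_V X)(m) = 0. In the last clause,
   g = f o X when X is viewed as a section M -> TM. *)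
Definition horizontal_dist (D : VM -> VM -> VM) (u : jet M 1) :
    set (smoothFun (jets M 1) -> R) :=
  [set w | tangent_space (X := jets M 1) u w /\
    exists X V : VM, [/\ passes_through X u,
      forall f, D V X f (jet_pi u) = 0 &
      forall (f : smoothFun (jets M 1)) (g : FM),
        (forall u', passes_through X u' -> f u' = g (jet_pi u')) ->
        w f = V g (jet_pi u)]].

End LeviCivita.

Section JetConnections.
Variables (R : realType) (n : nat) (M : manifold R n) (k : nat).
Local Notation FM := (smoothFun (base M)).
Local Notation VM := (vfield (base M)).
Local Notation J := (jets M k).
Local Notation FJ := (smoothFun J).
Local Notation VJ := (vfield J).

Definition vertical_space (j : J) : set (FJ -> R) :=
  [set v | tangent_space j v /\ forall f : FM, v (jet_pull k f) = 0].

Definition vertical (Y : VJ) : Prop := forall j, vertical_space j (vf_at Y j).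

Definition horizontal (H : J -> set (FJ -> R)) (Y : VJ) : Prop :=
  forall j, H j (vf_at Y j).

(* A smooth splitting TJ = H (+) V; the last clause is its smoothness: the
   components of a smooth vector field are smooth. *)
Definition jet_connection (H : J -> set (FJ -> R)) : Prop :=
  [/\ forall j, [/\ H j `<=` tangent_space j, H j 0 &
        forall (a : R) v w, H j v -> H j w -> H j (a *: v + w)],
      forall j, H j `&` vertical_space j `<=` [set 0],
      forall j v, tangent_space j v ->
        exists h w, [/\ H j h, vertical_space j w & v = h + w] &
      forall Y : VJ, exists2 Z, horizontal H Z & vertical (Y - Z)].

(* jet_connection provides exactly one such Z for each Y. *)
Definition hcomp (H : J -> set (FJ -> R)) (Y : VJ) : VJ :=
  xget 0 [set Z | horizontal H Z /\ vertical (Y - Z)].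

(* There is exactly one such Y when H is a jet_connection: smooth vector fields
   on M lift to J^k_0(M), and the horizontal component of a lift is a lift. *)
Definition hlift (H : J -> set (FJ -> R)) (X : VM) : VJ :=
  xget 0 [set Y | horizontal H Y /\
    forall f : FM, Y (jet_pull k f) = jet_pull k (X f)].

Definition gform (p : nat) : set (('I_p -> VM) -> FJ) :=
  [set alpha | is_form (@jet_pull _ _ M k) alpha].

Definition hform (p : nat) : set (('I_p -> VJ) -> FJ) :=
  [set w | is_form id w /\ forall Y i, vertical (Y i) -> w Y = 0].

Variable H : J -> set (FJ -> R).

Definition hhat (p : nat) (w : ('I_p -> VJ) -> FJ) : ('I_p -> VJ) -> FJ :=
  fun Y => w (hcomp H \o Y).

(* Linearity of zeta and its uniqueness on generalized forms follow from
   these conditions. *)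
Definition is_zeta
    (zeta : forall p, (('I_p -> VM) -> FJ) -> (('I_p -> VJ) -> FJ)) : Prop :=
  forall p, set_bij (@gform p) (@hform p) (zeta p) /\
    forall alpha, gform alpha ->
      forall X : 'I_p -> VM, zeta p alpha (hlift H \o X) = alpha X.

Variable zeta : forall p, (('I_p -> VM) -> FJ) -> (('I_p -> VJ) -> FJ).

Definition zeta_inv (p : nat) : (('I_p -> VJ) -> FJ) -> (('I_p -> VM) -> FJ) :=
  'pinv_(fun=> 0) (@gform p) (@zeta p).

Definition d4 (p : nat) (alpha : ('I_p -> VM) -> FJ) : ('I_p.+1 -> VM) -> FJ :=
  zeta_inv (hhat (ext_d (zeta alpha))).

Definition iota4 (X : VM) (p : nat) (alpha : ('I_p.+1 -> VM) -> FJ) :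
    ('I_p -> VM) -> FJ :=
  zeta_inv (contraction (hlift H X) (zeta alpha)).

(* d4 after iota_X; the contraction of a form of degree 0 is 0 *)
Definition d4_iota4 (X : VM) (p : nat) :
    (('I_p -> VM) -> FJ) -> ('I_p -> VM) -> FJ :=
  match p with
  | 0%N => fun=> 0
  | q.+1 => fun alpha => d4 (iota4 X alpha)
  end.

End JetConnections.

(* a connection on J^(k+1)_0(M) mapped into the horizontal distribution of D
   by the differential of jet_pr *)
Definition induced_connection (R : realType) (n : nat) (M : manifold R n.+1)
    (D : vfield (base M) -> vfield (base M) -> vfield (base M)) (k : nat)
    (H : jets M k.+1 -> set (smoothFun (jets M k.+1) -> R)) : Prop :=
  jet_connection H /\
  forall (j : jets M k.+1) w, H j w ->
    horizontal_dist D (jet_pr j) (fun f => w (jet_pr_pull k f)).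

(* Main.v *)
(** A form on J that kills vertical vectors is zeta of a generalized form, hence
    zeta^-1 is evaluation on horizontal lifts.  Since ^hX is horizontal,
    contraction by ^hX commutes with h_k, so the identity is h_k applied to
    Cartan's formula on J.  Cartan's formula is read off the Koszul formula by
    splitting off the terms containing the first argument; by induction on the
    degree it also shows that d preserves multilinear alternating maps, without
    which zeta^-1 would not be meaningful on h_k (d w). *)
Require Import Defs.
From mathcomp Require Import all_boot all_order all_algebra.
From mathcomp Require Import all_classical all_reals all_analysis.
From mathcomp Require Import ring.
Set Implicit Arguments.
Unset Strict Implicit.
Unset Printing Implicit Defensive.
Import GRing.Theory.
Local Open Scope classical_set_scope.
Local Open Scope ring_scope.

(* The analysis library also exports a constant named contraction. *)
Local Notation contraction := Defs.contraction.

(** * Argument tuples: prepending, omitting and replacing a slot *)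

Section ConsArg.
Variables (A : comPzRingType) (V : lmodType A).

Lemma cons_arg0 p (U : V) (Y : 'I_p -> V) : cons_arg U Y ord0 = U.
Proof. by rewrite /cons_arg unlift_none. Qed.

Lemma cons_argS p (U : V) (Y : 'I_p -> V) i : cons_arg U Y (lift ord0 i) = Y i.
Proof. by rewrite /cons_arg liftK. Qed.

Lemma cons_arg_eta p (Y : 'I_p.+1 -> V) :
  Y = cons_arg (Y ord0) (Y \o lift ord0).
Proof.
by apply/funext => i; case: (unliftP ord0 i) => [j|] ->;
  rewrite ?cons_argS ?cons_arg0.
Qed.

Lemma cons_arg_lift0 p (U : V) (Y : 'I_p -> V) :
  cons_arg U Y \o lift ord0 = Y.
Proof. by apply/funext => i /=; rewrite cons_argS. Qed.

Lemma lift_lift0 p (i : 'I_p.+1) : lift (lift ord0 i) ord0 = ord0.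
Proof. exact: val_inj. Qed.

(** The simplicial identity that turns omission of slot i+1 from a prepended tuple into omission of
    slot i from its tail. *)
Lemma lift_liftS p (i : 'I_p.+1) (j : 'I_p) :
  lift (lift ord0 i) (lift ord0 j) = lift ord0 (lift i j).
Proof. by apply: val_inj; rewrite /= /bump /= !add1n ltnS addnS. Qed.

Lemma cons_arg_liftS p (U : V) (Y : 'I_p.+1 -> V) i :
  cons_arg U Y \o lift (lift ord0 i) = cons_arg U (Y \o lift i).
Proof.
apply/funext => j /=; case: (unliftP ord0 j) => [l|] ->.
  by rewrite lift_liftS !cons_argS.
by rewrite lift_lift0 !cons_arg0.
Qed.

Lemma cons_arg_with0 p (U W : V) (Y : 'I_p -> V) :
  [eta cons_arg U Y with ord0 |-> W] = cons_arg W Y :> ('I_p.+1 -> V).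
Proof.
by apply/funext => j /=; case: (unliftP ord0 j) => [l|] ->;
  rewrite ?eqxx ?cons_arg0 // eq_sym (negbTE (neq_lift _ _)) !cons_argS.
Qed.

Lemma cons_arg_withS p (U W : V) (Y : 'I_p -> V) i :
  [eta cons_arg U Y with lift ord0 i |-> W] =
  cons_arg U [eta Y with i |-> W] :> ('I_p.+1 -> V).
Proof.
apply/funext => j /=; case: (unliftP ord0 j) => [l|] ->.
  by rewrite !cons_argS /= (inj_eq lift_inj).
by rewrite (negbTE (neq_lift _ _)) !cons_arg0.
Qed.

Lemma with_id p (Y : 'I_p -> V) i : [eta Y with i |-> Y i] = Y :> ('I_p -> V).
Proof. by apply/funext => j /=; case: eqP => // ->. Qed.

Lemma cons_arg_comp (g : V -> V) p (U : V) (Y : 'I_p -> V) :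
  g \o cons_arg U Y = cons_arg (g U) (g \o Y).
Proof.
by apply/funext => i; case: (unliftP ord0 i) => [j|] ->;
  rewrite /= ?cons_argS ?cons_arg0.
Qed.

End ConsArg.

(** * Algebra of multilinear alternating maps over a commutative ring *)

Section FormTheory.
Variables (A : comPzRingType) (V : lmodType A).
Local Notation form := (is_form (fun a : A => a)).
Implicit Types (p : nat) (a : A) (U W : V).

Lemma form_contraction p U (w : ('I_p.+1 -> V) -> A) :
  form w -> form (contraction U w).
Proof.
move=> [wl wa]; split=> [Y i a W Z|Y i j ij Yij]; rewrite /contraction.
  by rewrite -!cons_arg_withS wl.
apply: (wa _ (lift ord0 i) (lift ord0 j)); first by rewrite (inj_eq lift_inj).
by rewrite !cons_argS.
Qed.

Lemma form_consL p (w : ('I_p.+1 -> V) -> A) a U W (Y : 'I_p -> V) : form w ->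
  w (cons_arg (a *: U + W) Y) = a * w (cons_arg U Y) + w (cons_arg W Y).
Proof.
case=> wl _; rewrite -(cons_arg_with0 0 (a *: U + W)) wl.
by rewrite !cons_arg_with0.
Qed.

Lemma form_consD p (w : ('I_p.+1 -> V) -> A) U W (Y : 'I_p -> V) : form w ->
  w (cons_arg (U + W) Y) = w (cons_arg U Y) + w (cons_arg W Y).
Proof. by move=> fw; rewrite -[U in LHS]scale1r form_consL // mul1r. Qed.

Lemma form_slot0 p (w : ('I_p -> V) -> A) (Y : 'I_p -> V) i : form w ->
  Y i = 0 -> w Y = 0.
Proof.
move=> [wl _] Yi; have := wl Y i 1 0 0.
by rewrite scale1r addr0 mul1r -Yi with_id -[LHS]addr0 => /addrI.
Qed.

Lemma form_cons0 p (w : ('I_p.+1 -> V) -> A) (Y : 'I_p -> V) : form w ->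
  w (cons_arg 0 Y) = 0.
Proof. by move=> fw; apply: (form_slot0 (i := ord0) fw); rewrite cons_arg0. Qed.

Lemma form_consK p (w : ('I_p.+2 -> V) -> A) U (Y : 'I_p -> V) : form w ->
  w (cons_arg U (cons_arg U Y)) = 0.
Proof.
move=> [_ wa]; apply: (wa _ ord0 (lift ord0 ord0)) => //.
by rewrite cons_argS !cons_arg0.
Qed.

(** Polarization: expand the value 0 of w at U + W repeated in the first two slots. *)
Lemma form_swap p (w : ('I_p.+2 -> V) -> A) U W (Y : 'I_p -> V) : form w ->
  w (cons_arg U (cons_arg W Y)) = - w (cons_arg W (cons_arg U Y)).
Proof.
move=> fw; have f1 Z := form_contraction Z fw.
have := form_consK (U + W) Y fw.
rewrite form_consD // -[w (cons_arg U _)]/(contraction U w _).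
rewrite -[w (cons_arg W _)]/(contraction W w _) !form_consD //.
by rewrite /contraction !form_consK // add0r addr0 => /eqP; rewrite addr_eq0 => /eqP.
Qed.

(** Bringing slot i to the front takes i adjacent transpositions, each costing a sign. In the
    induction, all but the last are made in the contraction by the first argument. *)
Lemma form_move p (w : ('I_p.+1 -> V) -> A) (Y : 'I_p.+1 -> V) i W : form w ->
  w [eta Y with i |-> W] = (-1) ^+ i * w (cons_arg W (Y \o lift i)).
Proof.
elim: p w Y i W => [|p IH] w Y i W fw; rewrite (cons_arg_eta Y);
  case: (unliftP ord0 i) => [j|] ->;
  rewrite ?cons_arg_with0 ?cons_arg_lift0 ?mul1r //; first by case: j.
rewrite cons_arg_withS cons_arg_liftS -[LHS]/(contraction _ w _).
rewrite IH; last exact: form_contraction.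
by rewrite /contraction form_swap // lift0 exprS mulN1r mulrN mulNr.
Qed.

(** Criterion for inductions on the degree: once all contractions are forms, only linearity in the
    first slot and repetition of the first argument remain to be examined. *)
Lemma form_of_cons p (w : ('I_p.+1 -> V) -> A) :
  (forall U, form (contraction U w)) ->
  (forall a U W Y,
    w (cons_arg (a *: U + W) Y) = a * w (cons_arg U Y) + w (cons_arg W Y)) ->
  (forall U Y i, Y i = U -> w (cons_arg U Y) = 0) -> form w.
Proof.
move=> wc wl wa; split=> [Y i a U W|Y i j]; rewrite (cons_arg_eta Y).
  case: (unliftP ord0 i) => [j|] ->.
    by rewrite !cons_arg_withS; exact: (wc _).1.
  by rewrite !cons_arg_with0.
case: (unliftP ord0 i) => [i'|] ->; case: (unliftP ord0 j) => [j'|] -> //.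
- rewrite (inj_eq lift_inj) !cons_argS => ij Yij; exact: (wc _).2 ij Yij.
- by rewrite cons_argS cons_arg0 => _; exact: wa.
- by rewrite cons_argS cons_arg0 => _ /esym; exact: wa.
Qed.

Lemma form1 (w : ('I_1 -> V) -> A) :
  (forall a U W Y,
    w (cons_arg (a *: U + W) Y) = a * w (cons_arg U Y) + w (cons_arg W Y)) ->
  form w.
Proof.
by move=> wl; apply: form_of_cons => // [U|U Y []//]; split=> Y [].
Qed.

(** A later copy of the first argument can be moved next to it, because the contraction is already
    alternating; so repetition in the first two slots suffices. *)
Lemma formSS p (w : ('I_p.+2 -> V) -> A) :
  (forall U, form (contraction U w)) ->
  (forall a U W Y,
    w (cons_arg (a *: U + W) Y) = a * w (cons_arg U Y) + w (cons_arg W Y)) ->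
  (forall U Y, w (cons_arg U (cons_arg U Y)) = 0) -> form w.
Proof.
move=> wc wl wa; apply: form_of_cons => // U Y i YU.
rewrite -[LHS]/(contraction U w Y) -(with_id Y i) YU form_move //.
by rewrite /contraction wa mulr0.
Qed.

Lemma form_add p (v w : ('I_p -> V) -> A) : form v -> form w -> form (v + w).
Proof.
move=> [vl va] [wl wa]; split=> [Y i a U W|Y i j ij Yij].
  by rewrite -![(v + w) _]/(v _ + w _) vl wl mulrDr addrACA.
by rewrite -[(v + w) _]/(v _ + w _) (va _ _ _ ij) // (wa _ _ _ ij) // addr0.
Qed.

Lemma form_opp p (w : ('I_p -> V) -> A) : form w -> form (- w).
Proof.
move=> [wl wa]; split=> [Y i a U W|Y i j ij Yij].
  by rewrite -![(- w) _]/(- w _) wl opprD mulrN.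
by rewrite -[(- w) _]/(- w _) (wa _ _ _ ij) // oppr0.
Qed.

End FormTheory.

(** * Lie derivative, exterior derivative and Cartan's formula *)

Section Cartan.
Variables (R : realType) (E : normedModType R) (X : chartedSpace E).
Local Notation F := (smoothFun X).
Local Notation vfield := (vfield X).
Local Notation form := (is_form (fun a : F => a)).
Implicit Types (U W Z : vfield) (a f g : F).

Lemma vf0 U : U 0 = 0.
Proof. by apply: (addrI (U 0)); rewrite -vfD !addr0. Qed.

Lemma bracketZDr U a W Z :
  bracket U (a *: W + Z) = U a *: W + (a *: bracket U W + bracket U Z).
Proof.
apply: vfieldP => f /=; rewrite vfD vf_leibniz mulrBr opprD !addrA.
rewrite [W f * _]mulrC [a * _ + _]addrC -!addrA; congr (_ + _); congr (_ + _).
by rewrite addrCA.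
Qed.

Lemma bracketC U W : bracket U W = - bracket W U.
Proof. by apply: vfieldP => f /=; rewrite opprB. Qed.

Lemma bracketZDl a U W Z :
  bracket (a *: U + W) Z = a *: bracket U Z + (- Z a *: U + bracket W Z).
Proof.
rewrite bracketC bracketZDr !opprD (bracketC U) (bracketC W) scalerN scaleNr.
by rewrite addrCA.
Qed.

Lemma bracketUU U : bracket U U = 0.
Proof. by apply: vfieldP => f /=; rewrite subrr. Qed.

(** The summand of slot 0 in L_U w is the contraction by [U, W]; the other summands belong to L_U of
    the contracted form. *)
Lemma lie_contraction U W p (w : ('I_p.+1 -> vfield) -> F) :
  contraction W (lie_derivative U w) =
  lie_derivative U (contraction W w) - contraction (bracket U W) w.
Proof.
apply/funext => Y; rewrite -[RHS]/(_ Y - _ Y) /contraction /lie_derivative.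
rewrite big_ord_recl cons_arg_with0 cons_arg0 opprD -addrA [- w _ + _]addrC.
congr (_ + (- _ + _)); apply: eq_bigr => i _.
by rewrite cons_arg_withS cons_argS.
Qed.

(** U also differentiates the coefficient a. In [form_lie] the resulting term cancels against the
    one that [bracketZDr] produces. *)
Lemma lieZD U p a (v w : ('I_p -> vfield) -> F) Y :
  lie_derivative U (fun Y => a * v Y + w Y) Y =
  U a * v Y + (a * lie_derivative U v Y + lie_derivative U w Y).
Proof.
rewrite /lie_derivative vfD vf_leibniz big_split /= -mulr_sumr mulrBr opprD.
rewrite [v Y * _]mulrC [a * _ + _]addrC -!addrA; congr (_ + (_ + _)).
by rewrite addrCA.
Qed.

(** Induction on the degree: [lie_contraction] expresses each contraction of L_U w by forms of lower
    degree. *)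
Lemma form_lie U p (w : ('I_p -> vfield) -> F) :
  form w -> form (lie_derivative U w).
Proof.
elim: p w => [|p IH] w fw; first by split=> Y [].
have lc : forall W, form (contraction W (lie_derivative U w)).
  move=> W; rewrite lie_contraction; apply: form_add.
    by apply: IH; exact: form_contraction.
  by apply: form_opp; exact: form_contraction.
have lE W Y : lie_derivative U w (cons_arg W Y) =
    lie_derivative U (contraction W w) Y - w (cons_arg (bracket U W) Y).
  by rewrite -[LHS]/(contraction W _ Y) lie_contraction.
have ll a W Z Y : lie_derivative U w (cons_arg (a *: W + Z) Y) =
    a * lie_derivative U w (cons_arg W Y) + lie_derivative U w (cons_arg Z Y).
  rewrite !lE (_ : contraction _ w =
      fun Y => a * contraction W w Y + contraction Z w Y).
    rewrite lieZD bracketZDr form_consL // form_consL //.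
    rewrite -[w (cons_arg W Y)]/(contraction W w Y); ring.
  by apply/funext => Y'; rewrite /contraction form_consL.
case: p => [|p] in w fw IH lc lE ll *; first exact: form1.
apply: formSS => // W Y.
(* Since i_W i_W w = 0, what is left is - w(W, [U, W], Y) - w([U, W], W, Y), which vanishes by
   antisymmetry. *)
rewrite lE -[X in X - _]/(contraction W _ Y) lie_contraction.
rewrite -[(_ - _) Y]/(_ Y - _ Y) (_ : contraction W _ = fun=> 0); last first.
  by apply/funext => Y'; rewrite /contraction form_consK.
rewrite /lie_derivative vf0 big1 // subrr sub0r /contraction.
by rewrite form_swap // opprK subrr.
Qed.

(** The bracket half of the Koszul formula, set to 0 on functions so that [ext_dE] is uniform in the
    degree. *)
Definition ext_d_bracket p : (('I_p -> vfield) -> F) -> ('I_p.+1 -> vfield) -> F :=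
  match p with
  | 0%N => fun _ _ => 0
  | q.+1 => fun w Y => \sum_(i < q.+2) \sum_(j < q.+2 | (i < j)%N)
      (-1) ^+ (i + j) *
      w (cons_arg (bracket (Y i) (Y j))
           (fun k : 'I_q => Y (lift j (lift (inord i : 'I_q.+1) k))))
  end.

Lemma ext_dE p (w : ('I_p -> vfield) -> F) Y :
  ext_d w Y =
  \sum_(i < p.+1) (-1) ^+ i * Y i (w (Y \o lift i)) + ext_d_bracket w Y.
Proof. by case: p w Y => // w Y; rewrite big_ord1 addr0 mul1r. Qed.

(** The pairs (0, j) give the brackets [U, Y_j], moved back into slot j by [form_move]. A pair of
    positive indices cancels against the corresponding pair for i_U w: the shift of both indices
    keeps the sign, while U and the bracket stand in opposite order. *)
Lemma ext_d_bracket_contraction U p (w : ('I_p.+1 -> vfield) -> F) Y :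
  form w ->
  ext_d_bracket w (cons_arg U Y) + ext_d_bracket (contraction U w) Y =
  - \sum_(i < p.+1) w [eta Y with i |-> bracket U (Y i)].
Proof.
move=> fw; rewrite [ext_d_bracket w _]/= big_ord_recl.
rewrite [X in X + _ + _]big_mkcond [X in X + _ + _]big_ord_recl /=.
rewrite add0r -[RHS]addr0 -addrA; congr (_ + _).
  rewrite -sumrN; apply: eq_bigr => j _.
  rewrite form_move // add0n -[bump 0 j]/j.+1 exprS mulN1r mulNr cons_argS cons_arg0.
  congr (- (_ * w (cons_arg _ _))); apply/funext => k /=.
  rewrite (_ : inord 0 = ord0); last by apply: val_inj; rewrite /= inordK.
  by rewrite lift_liftS cons_argS.
(* In degree 1 there is no pair of positive indices, and i_U w is a function, whose bracket half is
   0. *)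
case: p w Y fw => [|p] w Y fw.
  rewrite big_ord1 big_mkcond big_ord_recl big_ord1 /=.
  by rewrite !addr0.
rewrite -[ext_d_bracket (contraction U w) Y]/(\sum_(i < p.+2) _) -big_split /=.
apply: big1 => i _; rewrite big_mkcond big_ord_recl /= add0r.
rewrite [X in _ + X]big_mkcond -big_split /=; apply: big1 => j _.
rewrite -[bump 0 i]/i.+1 -[bump 0 j]/j.+1 ltnS; case: ifP => ij; last by rewrite addr0.
rewrite !cons_argS addSn addnS !exprS !mulN1r opprK -mulrDr /contraction.
rewrite [X in _ * (_ + X)]form_swap // -[RHS](mulr0 ((-1) ^+ (i + j))).
congr (_ * _); apply/eqP; rewrite subr_eq0; apply/eqP; congr (w (cons_arg _ _)).
(* From i < j, both uses of [inord] are in range and do not fall back on their default 0. *)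
have lti : (i < p.+1)%N by rewrite (leq_trans ij) // -ltnS.
have -> : inord i.+1 = lift ord0 (inord i) :> 'I_p.+2.
  by apply: val_inj; rewrite /= !inordK // ltnW.
apply/funext => k /=; case: (unliftP ord0 k) => [l|] ->.
  by rewrite !lift_liftS !cons_argS.
by rewrite !lift_lift0 !cons_arg0.
Qed.

Lemma cartan0 U (w : ('I_0 -> vfield) -> F) :
  contraction U (ext_d w) = lie_derivative U w.
Proof.
apply/funext => Y; rewrite /contraction /lie_derivative big_ord0 subr0 /=.
by rewrite cons_arg0 cons_arg_lift0.
Qed.

(** Among the derivative terms of i_U d w, the one of index 0 is U(w Y); those of index i+1 are
    opposite to the terms of index i in d i_U w. The bracket halves supply the remaining part of L_U
    w. *)
Lemma cartanS U p (w : ('I_p.+1 -> vfield) -> F) : form w ->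
  contraction U (ext_d w) + ext_d (contraction U w) = lie_derivative U w.
Proof.
move=> fw; apply/funext => Y; rewrite -[LHS]/(_ Y + _ Y).
rewrite /contraction !ext_dE -/(contraction U w) addrACA.
rewrite ext_d_bracket_contraction // big_ord_recl mul1r cons_arg0.
rewrite cons_arg_lift0; congr (_ - _).
rewrite -addrA -big_split /= big1 ?addr0 // => i _.
by rewrite cons_argS cons_arg_liftS -[bump 0 i]/i.+1 exprS mulN1r mulNr addNr.
Qed.

Lemma ext_d_bracketZD p a (v w : ('I_p -> vfield) -> F) Y :
  ext_d_bracket (fun Y => a * v Y + w Y) Y =
  a * ext_d_bracket v Y + ext_d_bracket w Y.
Proof.
case: p v w Y => [|p] v w Y /=; first by rewrite mulr0 addr0.
rewrite mulr_sumr -big_split /=; apply: eq_bigr => i _.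
rewrite mulr_sumr -big_split /=; apply: eq_bigr => j _.
by rewrite mulrDr mulrCA.
Qed.

(** The additional sum is the value of da ∧ v, coming from the Leibniz rule in the derivative terms;
    the bracket half is linear over functions. *)
Lemma ext_dZD p a (v w : ('I_p -> vfield) -> F) Y :
  ext_d (fun Y => a * v Y + w Y) Y =
  \sum_(i < p.+1) (-1) ^+ i * (Y i a * v (Y \o lift i)) +
  (a * ext_d v Y + ext_d w Y).
Proof.
rewrite !ext_dE ext_d_bracketZD mulrDr addrACA [RHS]addrA; congr (_ + _).
rewrite mulr_sumr -!big_split /=; apply: eq_bigr => i _.
rewrite vfD vf_leibniz; ring.
Qed.

Lemma ext_d_cst0 p Y : ext_d (fun _ : 'I_p -> vfield => 0) Y = 0.
Proof.
rewrite ext_dE big1 ?add0r; last by move=> i _; rewrite vf0 mulr0.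
case: p Y => //= p Y; apply: big1 => i _; apply: big1 => j _.
by rewrite mulr0.
Qed.

(** Induction on the degree: Cartan's formula gives i_U d w = L_U w - d i_U w, where the first term
    is a form by [form_lie] and the second by the induction hypothesis. *)
Lemma form_ext_d p (w : ('I_p -> vfield) -> F) : form w -> form (ext_d w).
Proof.
elim: p w => [|p IH] w fw.
  apply: form1 => a U W Y.
  by rewrite /= !cons_arg0 !cons_arg_lift0.
have dE U Y : ext_d w (cons_arg U Y) =
    lie_derivative U w Y - ext_d (contraction U w) Y.
  by rewrite -(cartanS U fw) -[(_ + _) Y]/(_ Y + _ Y) addrK.
apply: formSS.
- move=> U; have -> : contraction U (ext_d w) =
      lie_derivative U w - ext_d (contraction U w).
    by apply/funext => Y; exact: dE.
  apply: form_add; first exact: form_lie.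
  by apply: form_opp; apply: IH; exact: form_contraction.
- move=> a U W Y; rewrite !dE.
  rewrite (_ : contraction _ w =
      fun Y => a * contraction U w Y + contraction W w Y);
    last by apply/funext => Y'; rewrite /contraction form_consL.
  rewrite ext_dZD.
  (* The summand -(Y_i a) U of the bracket leaves a sum which, after [form_move], is the value of da
     ∧ i_U w; it cancels the additional sum of [ext_dZD]. *)
  have -> : lie_derivative (a *: U + W) w Y = a * lie_derivative U w Y +
      lie_derivative W w Y + \sum_i Y i a * w [eta Y with i |-> U].
    rewrite /lie_derivative mulrBr mulr_sumr.
    rewrite [(a *: U + W) _]/(a * U _ + W _) -!addrA; congr (_ + _).
    rewrite -!sumrN addrCA; congr (_ + _); rewrite -!big_split /=.
    apply: eq_bigr => i _; rewrite bracketZDl !fw.1; ring.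
  rewrite (eq_bigr _ (fun i _ => congr1 _ (form_move Y i U fw))).
  rewrite (eq_bigr (fun i : 'I_p.+1 =>
      (-1) ^+ i * (Y i a * contraction U w (Y \o lift i)))).
    ring.
  by move=> i _; rewrite /contraction mulrCA.
(* Cartan's formula for i_U w, with i_U i_U w = 0, reduces the second term to L_U i_U w; this equals
   i_U L_U w because [U, U] = 0. *)
- move=> U Y; rewrite dE.
  have -> : ext_d (contraction U w) (cons_arg U Y) =
      lie_derivative U (contraction U w) Y.
    rewrite -[LHS]/(contraction U (ext_d (contraction U w)) Y).
    case: p w fw Y {IH dE} => [|p] w fw Y; first by rewrite cartan0.
    rewrite -cartanS; last exact: form_contraction.
    rewrite -[RHS]/(_ Y + _ Y) (_ : contraction U (contraction U w) = fun=> 0).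
      by rewrite ext_d_cst0 addr0.
    by apply/funext => Z; rewrite /contraction form_consK.
  rewrite -[lie_derivative U w _]/(contraction U (lie_derivative U w) Y).
  rewrite lie_contraction -[(_ - contraction _ _) Y]/(_ Y - _ Y) bracketUU.
  by rewrite /contraction form_cons0 // subr0 subrr.
Qed.

End Cartan.

(** * Horizontal components, horizontal forms and the inverse of zeta *)

Section HorizontalComponent.
Variables (R : realType) (n k : nat) (M : manifold R n).
Local Notation J := (jets M k).
Local Notation FJ := (smoothFun J).
Local Notation VJ := (vfield J).
Variable H : J -> set (FJ -> R).
Hypothesis conn : jet_connection H.
Implicit Types (Y Z : VJ) (a : FJ).

Lemma vf_at_tangent Y j : tangent_space j (vf_at Y j).
Proof.
split=> [a f g|f g]; first by rewrite /vf_at vf_linear.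
by rewrite /vf_at vf_leibniz.
Qed.

Lemma vf_atZD a Y Z j : vf_at (a *: Y + Z) j = a j *: vf_at Y j + vf_at Z j.
Proof. by apply/funext. Qed.

Lemma horizontalZD a Y Z :
  horizontal H Y -> horizontal H Z -> horizontal H (a *: Y + Z).
Proof.
move=> hY hZ j; rewrite vf_atZD; have [/(_ j)[_ _ HZD] _ _ _] := conn.
exact: HZD.
Qed.

Lemma horizontal0 : horizontal H 0.
Proof. by move=> j; have [/(_ j)[_ H0 _] _ _ _] := conn. Qed.

Lemma verticalZD a Y Z : vertical Y -> vertical Z -> vertical (a *: Y + Z).
Proof.
move=> vY vZ j; split; first exact: vf_at_tangent.
move=> f; have [_ Yf] := vY j; have [_ Zf] := vZ j.
by rewrite vf_atZD -[LHS]/(_ * vf_at Y j _ + vf_at Z j _) Yf Zf mulr0 addr0.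
Qed.

Lemma horizontal_vertical_eq0 Y : horizontal H Y -> vertical Y -> Y = 0.
Proof.
move=> hY vY; apply: vfieldP => f; apply: val_inj; apply/funext => j.
have [_ /(_ j) HV _ _] := conn.
by have /= := HV _ (conj (hY j) (vY j)) => /(congr1 (fun v => v f)).
Qed.

Lemma hcompP Y : horizontal H (hcomp H Y) /\ vertical (Y - hcomp H Y).
Proof.
have [_ _ _ /(_ Y)[Z hZ vZ]] := conn.
by apply: (@xgetPex _ 0 [set Z | horizontal H Z /\ vertical (Y - Z)]); exists Z.
Qed.

(** Two horizontal components of Y differ by a field that is both horizontal and vertical, hence 0.
    The other properties of [hcomp] follow by exhibiting a candidate. *)
Lemma hcomp_eq Y Z : horizontal H Z -> vertical (Y - Z) -> hcomp H Y = Z.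
Proof.
move=> hZ vZ; have [hY vY] := hcompP Y; apply/eqP; rewrite -subr_eq0; apply/eqP.
apply: horizontal_vertical_eq0.
  rewrite addrC -scaleN1r; exact: horizontalZD.
have -> : hcomp H Y - Z = -1 *: (Y - hcomp H Y) + (Y - Z).
  by rewrite scaleN1r opprB addrA subrK.
exact: verticalZD.
Qed.

Lemma vertical0 : vertical (0 : VJ).
Proof. by move=> j; split=> //; exact: vf_at_tangent. Qed.

Lemma hcomp_id Y : horizontal H Y -> hcomp H Y = Y.
Proof. by move=> hY; apply: hcomp_eq => //; rewrite subrr; exact: vertical0. Qed.

Lemma hcomp_vertical Y : vertical Y -> hcomp H Y = 0.
Proof. by move=> vY; apply: hcomp_eq; [exact: horizontal0|rewrite subr0]. Qed.

Lemma hcompZD a Y Z : hcomp H (a *: Y + Z) = a *: hcomp H Y + hcomp H Z.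
Proof.
have [hY vY] := hcompP Y; have [hZ vZ] := hcompP Z.
apply: hcomp_eq; first exact: horizontalZD.
rewrite opprD addrACA -scalerBr; exact: verticalZD.
Qed.

(** Either outcome of [xget] is horizontal: a lift by its defining condition, the default 0 by
    [horizontal0]. *)
Lemma hlift_horizontal U : horizontal H (hlift H U).
Proof. by rewrite /hlift; case: xgetP => [Y _ []|_] //; exact: horizontal0. Qed.

(** [hcomp] is linear over functions and kills vertical fields. *)
Lemma hform_hhat p (w : ('I_p -> VJ) -> FJ) : is_form id w -> hform (hhat H w).
Proof.
move=> fw; have hc (Y : 'I_p -> VJ) i Z :
    hcomp H \o [eta Y with i |-> Z] =
    [eta hcomp H \o Y with i |-> hcomp H Z] :> ('I_p -> VJ).
  by apply/funext => j /=; case: eqP.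
split; first split=> [Y i a U W|Y i j ij Yij]; rewrite /hhat.
- by rewrite !hc hcompZD fw.1.
- by apply: (fw.2 _ _ _ ij); rewrite /= Yij.
- move=> Y i vY; apply: (form_slot0 (i := i) fw); exact: hcomp_vertical.
Qed.

Lemma hform_contraction U p (w : ('I_p.+1 -> VJ) -> FJ) :
  hform w -> hform (contraction U w).
Proof.
move=> [fw vw]; split; first exact: form_contraction.
by move=> Y i vY; apply: (vw _ (lift ord0 i)); rewrite cons_argS.
Qed.

Lemma hform_add p (v w : ('I_p -> VJ) -> FJ) : hform v -> hform w -> hform (v + w).
Proof.
move=> [fv vv] [fw vw]; split; first exact: form_add.
by move=> Y i vY; rewrite -[LHS]/(v Y + w Y) (vv _ i) // (vw _ i) // addr0.
Qed.

Lemma contraction_hhat U p (w : ('I_p.+1 -> VJ) -> FJ) : horizontal H U ->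
  contraction U (hhat H w) = hhat H (contraction U w).
Proof.
move=> hU; apply/funext => Y.
by rewrite /contraction /hhat cons_arg_comp hcomp_id.
Qed.

Variable zeta : forall p,
  (('I_p -> vfield (base M)) -> FJ) -> (('I_p -> VJ) -> FJ).
Hypothesis zetaP : is_zeta H zeta.

Lemma zeta_invP p (w : ('I_p -> VJ) -> FJ) : hform w ->
  gform (zeta_inv zeta w) /\ zeta (zeta_inv zeta w) = w.
Proof.
move=> hw; have [[_ inj sur] _] := zetaP p.
have [al gal <-] := sur w hw; by rewrite /zeta_inv pinvKV ?inE.
Qed.

(** The characterizing identity of zeta, read at the generalized form zeta^-1 w. It makes the
    pseudo-inverse explicit, and additivity visible. *)
Lemma zeta_invE p (w : ('I_p -> VJ) -> FJ) : hform w ->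
  zeta_inv zeta w = fun B => w (hlift H \o B).
Proof.
move=> hw; have [gw zw] := zeta_invP hw; apply/funext => B.
by have [_ /(_ _ gw B) <-] := zetaP p; rewrite zw.
Qed.

Lemma zeta_invD p (v w : ('I_p -> VJ) -> FJ) : hform v -> hform w ->
  zeta_inv zeta (v + w) = zeta_inv zeta v + zeta_inv zeta w.
Proof. by move=> hv hw; rewrite !zeta_invE //; exact: hform_add. Qed.

Lemma hform_zeta p (alpha : ('I_p -> vfield (base M)) -> FJ) :
  gform alpha -> hform (zeta alpha).
Proof. by have [[zetaf _ _] _] := zetaP p; exact: zetaf. Qed.

End HorizontalComponent.

(** * Cartan's formula for generalized forms *)

Theorem proposition2p59 (R : realType) (n k : nat) (M : manifold R n.+1)
    (eta : vfield (base M) -> vfield (base M) -> smoothFun (base M))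
    (eta_metric : lorentz_metric eta)
    (D : vfield (base M) -> vfield (base M) -> vfield (base M))
    (D_levi_civita : levi_civita eta D)
    (H : jets M k.+1 -> set (smoothFun (jets M k.+1) -> R))
    (H_induced : induced_connection D H)
    (zeta : forall p, (('I_p -> vfield (base M)) -> smoothFun (jets M k.+1)) ->
                      (('I_p -> vfield (jets M k.+1)) -> smoothFun (jets M k.+1)))
    (zetaP : is_zeta H zeta)
    (p : nat) (alpha : ('I_p -> vfield (base M)) -> smoothFun (jets M k.+1))
    (alpha_gform : gform alpha) (X : vfield (base M)) :
  iota4 H zeta X (d4 H zeta alpha) + d4_iota4 H zeta X alpha =
  zeta_inv zeta (hhat H (lie_derivative (hlift H X) (zeta p alpha))).
Proof.
have [conn _] := H_induced.
have hU := hlift_horizontal conn X; set U := hlift H X in hU *.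
have hz : hform (zeta p alpha) := hform_zeta zetaP alpha_gform.
have hd := hform_hhat conn (form_ext_d hz.1).
(* As h_k d zeta(alpha) is a horizontal form, zeta cancels the zeta^-1 inside d4. *)
rewrite /iota4 /d4 (zeta_invP zetaP hd).2 contraction_hhat // -/U.
case: p alpha {alpha_gform} hz hd => [|p] alpha hz hd; first by rewrite cartan0 addr0.
have hc := hform_contraction U hz.
have hdc := hform_hhat conn (form_ext_d hc.1).
have hcd := hform_contraction U hd; rewrite contraction_hhat // in hcd.
rewrite /= /d4 /iota4 -/U (zeta_invP zetaP hc).2.
rewrite -(zeta_invD zetaP hcd hdc); congr (zeta_inv _ _).
(* [hhat] is precomposition with [hcomp H], so it distributes over the sum by computation. *)
by rewrite -(cartanS U hz.1).
Qed.
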